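(* For every positive integer $n$, there exists a non-negative integer $d$ such that $n$ is a $d$-congruent number.
   Context: Let $d$ be a non-negative integer. A positive integer $n$ is called a $d$-congruent number if it is the area of a right trapezoid with parallel sides $d$ and $a+d$, height $b$ and slanted side $c$, where $a,b,c$ are positive rational numbers; that is, if there exist positive rational numbers $a,b,c$ with $n=\frac{(a+2d)b}{2}$ and $a^2+b^2=c^2$. (For $d=0$ this is the classical notion of congruent number.) *)

(* Defs.v *)
From mathcomp Require Import all_boot all_order all_algebra.

Set Implicit Arguments.
Unset Strict Implicit.
Unset Printing Implicit Defensive.

Import Order.TTheory GRing.Theory Num.Theory.
Local Open Scope ring_scope.

(* n is the area of a right trapezoid with parallel sides d and a + d,
   height b and slanted side c. *)
Definition d_congruent (d n : nat) : Prop :=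
  (0 < n)%N /\
  exists a b c : rat,
    [/\ 0 < a, 0 < b, 0 < c,
        n%:R = (a + 2%:R * d%:R) * b / 2%:R
      & a ^+ 2 + b ^+ 2 = c ^+ 2].

(* Main.v *)
Require Import Defs.
From mathcomp Require Import all_boot all_order all_algebra.
From mathcomp Require Import ring lra.

Import Order.TTheory GRing.Theory Num.Theory.
Local Open Scope ring_scope.

(** Write a right triangle as b / a = 2m / (m^2 - 1) with m > 1 rational.
    Eliminating b, the area equation becomes a quadratic in a with solution
    a = w - d, where w^2 - d^2 = n (m - 1/m).  So n is d-congruent as soon as
    n (m - 1/m) splits, for some rational m > 1, as (w - d) (w + d) with
    w > d rational; equivalently, the elliptic curve
    y^2 = x^3 + d^2 x^2 - n^2 x has a rational point with x = n m > n.

    For n > 1 the choice m = n gives n^2 - 1 = (n - 1) (n + 1), so w = n and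
    d = 1.  For n = 1 this point degenerates, since m = 1 gives a = 0.  There
    m = 25 works, because 25 - 1/25 = (2/5) (312/5) and the two factors differ
    by the even integer 62, so d = 31. *)

(** The values come from m = n: then a = n - 1, and b = 2 n a / (n^2 - 1). *)
Lemma d_congruent_1 (n : nat) : (1 < n)%N -> d_congruent 1 n.
Proof.
move=> n_gt1; split; first exact: ltnW.
have x_gt1 : 1 < n%:R :> rat by rewrite ltr1n.
set x : rat := n%:R in x_gt1 *.
have x1_gt0 : 0 < x + 1 by lra.
have x1_neq0 : x + 1 != 0 by rewrite gt_eqF.
exists (x - 1), (2%:R * x / (x + 1)), ((x ^+ 2 + 1) / (x + 1)); split.
- by lra.
- by rewrite divr_gt0 //; lra.
- by rewrite divr_gt0 //; nra.
- by field.
- by field.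
Qed.

(** The values come from m = 25: then a = 2/5, and b = 50 a / 624. *)
Lemma d_congruent_31_1 : d_congruent 31 1.
Proof.
split=> //.
by exists (2%:R / 5%:R), (5%:R / 156%:R), (313%:R / 780%:R); split; lra.
Qed.

Theorem theorem1p6 (n : nat) (hn : (0 < n)%N) :
  exists d : nat, d_congruent d n.
Proof.
case: (ltngtP n 1) hn => [|n_gt1 _|-> _]; first by case: n.
- by exists 1%N; apply: d_congruent_1.
- by exists 31%N; apply: d_congruent_31_1.
Qed.
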